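(* For every $\varepsilon\in[0,1)$ one has $B(\varepsilon)\subset\mathcal{D}^0_{2,\varepsilon}\subset D(\varepsilon)$, where for $\varepsilon\in[0,\tfrac12)$: $D(\varepsilon)=\{(x,y)\in\mathbb{R}^2: -x-\varepsilon\le y<x+1-\varepsilon,\ -\varepsilon\le x<1-\varepsilon\}$, $B(\varepsilon)=\{(x,y)\in\mathbb{R}^2: -x-\varepsilon\le y<x+1-\varepsilon,\ -\varepsilon\le x\le \tfrac23-\varepsilon\}$; for $\varepsilon\in[\tfrac12,1)$: $D(\varepsilon)=\{(x,y)\in\mathbb{R}^2: -x-1+\varepsilon< y\le x+\varepsilon,\ -(1-\varepsilon)< x\le\varepsilon\}$, $B(\varepsilon)=\{(x,y)\in\mathbb{R}^2: -x-1+\varepsilon< y\le x+\varepsilon,\ -(1-\varepsilon)< x\le \tfrac23-(1-\varepsilon)\}$.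
   Context: For $\varepsilon\in[0,1)$ and $\mathbf{r}=(r_1,r_2)\in\mathbb{R}^2$, define $\tau_{\mathbf{r},\varepsilon}:\mathbb{Z}^2\to\mathbb{Z}^2$ by $\tau_{\mathbf{r},\varepsilon}(z_1,z_2)=(z_2,-\lfloor r_1z_1+r_2z_2+\varepsilon\rfloor)$. It is called an $\varepsilon$-shift radix system ($\varepsilon$-SRS) if for every $\mathbf{z}\in\mathbb{Z}^2$ there is $k\in\mathbb{N}$ with $\tau_{\mathbf{r},\varepsilon}^k(\mathbf{z})=(0,0)$. Let $\mathcal{D}^0_{2,\varepsilon}=\{\mathbf{r}\in\mathbb{R}^2:\tau_{\mathbf{r},\varepsilon}\text{ is an }\varepsilon\text{-SRS}\}$. *)

(* Defs.v *)
From Stdlib Require Export Reals ZArith Zfloor Ensembles.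

Open Scope R_scope.

Definition tau (r : R * R) (eps : R) (z : Z * Z) : Z * Z :=
  (snd z, (- Zfloor (fst r * IZR (fst z) + snd r * IZR (snd z) + eps))%Z).

Definition is_eps_SRS (r : R * R) (eps : R) : Prop :=
  forall z : Z * Z, exists k : nat, Nat.iter k (tau r eps) z = (0%Z, 0%Z).

Definition D0_2 (eps : R) : Ensemble (R * R) :=
  fun r => is_eps_SRS r eps.

(* Outside [0,1) the sets Dset and Bset are empty by convention. *)
Definition Dset (eps : R) : Ensemble (R * R) :=
  fun p => let (x, y) := p in
    (0 <= eps < 1/2 /\
       - x - eps <= y < x + 1 - eps /\ - eps <= x < 1 - eps)
    \/
    (1/2 <= eps < 1 /\
       - x - 1 + eps < y <= x + eps /\ - (1 - eps) < x <= eps).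

Definition Bset (eps : R) : Ensemble (R * R) :=
  fun p => let (x, y) := p in
    (0 <= eps < 1/2 /\
       - x - eps <= y < x + 1 - eps /\ - eps <= x <= 2/3 - eps)
    \/
    (1/2 <= eps < 1 /\
       - x - 1 + eps < y <= x + eps /\ - (1 - eps) < x <= 2/3 - (1 - eps)).

(* Main.v *)
From Stdlib Require Import Lra Lia List Classical.
Require Import Defs.

(** Orbits are read as integer sequences u with
    x u_n + y u_(n+1) + u_(n+2) in a half-open unit interval whose lower end is
    -e with e <= 1/2; for eps >= 1/2 the sequence is negated, e = 1 - eps, and
    the interval is closed on the other side.

    Outside D(eps) one exhibits a set of nonzero states stable under the
    dynamics: cycles 1,1,1,..., 1,-1,1,... or 1,0,1,..., growing sequences of
    constant or alternating sign, or, when no a <> 0 has x a in the interval,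
    the set of all nonzero states.

    Inside B(eps), put
      Lam(a,b) = (1+x)(a^2+b^2) + 2yab - (1-2e)(a+b).
    A step (a,b) -> (b,c) with jump g = a - c lowers Lam by
    g ((1-x) g + 2 delta - (1-2e)), where delta = xa + yb + c and the last two
    terms have absolute value at most 1 together.  Since 1 - x >= 1/3, only
    jumps |g| <= 3 can fail to lower Lam.  In the coordinates
    p = (1+x)a + yb and q = (1+x)b + ya the step is
    (p,q) -> (q - yg, p - (1+x)g), which is affine in (p,q,x,y,e) once g is
    known, so a finite case analysis on the jumps shows that Lam drops within
    seven steps, or 0 is reached.  As Lam has finite sublevel sets on Z^2,
    every orbit ends in 0. *)

(** * A common form for the two ranges of [eps] *)

Definition window (s : bool) (e t : R) : Prop :=
  if s then - e < t <= 1 - e else - e <= t < 1 - e.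

Definition srs_seq (s : bool) (x y e : R) (u : nat -> Z) : Prop :=
  forall n, window s e
    (x * IZR (u n) + y * IZR (u (S n)) + IZR (u (S (S n)))).

Definition hits_zero (u : nat -> Z) : Prop :=
  exists n, u n = 0%Z /\ u (S n) = 0%Z.

(** This is B(eps) with the range of [e] included; [outer_region] is D(eps). The flag [s] is [true]
    for eps >= 1/2, with e = 1 - eps. *)
Definition inner_region (s : bool) (x y e : R) : Prop :=
  (if s then 0 < e <= 1/2 /\ - e < x /\ - e < x + y /\ y - x <= 1 - e
   else 0 <= e < 1/2 /\ - e <= x /\ - e <= x + y /\ y - x < 1 - e)
  /\ x <= 2/3 - e.

Definition outer_region (s : bool) (x y e : R) : Prop :=
  if s then - e < x <= 1 - e /\ - e < x + y /\ y - x <= 1 - e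
  else - e <= x < 1 - e /\ - e <= x + y /\ y - x < 1 - e.

(** * Orbits as sequences *)

Lemma window_unique (s : bool) (e t : R) (c d : Z) :
  window s e (t + IZR c) -> window s e (t + IZR d) -> c = d.
Proof.
  intros hc hd.
  assert (h1 : IZR c < IZR (d + 1))
    by (rewrite plus_IZR; destruct s; cbn in hc, hd; lra).
  assert (h2 : IZR d < IZR (c + 1))
    by (rewrite plus_IZR; destruct s; cbn in hc, hd; lra).
  apply lt_IZR in h1; apply lt_IZR in h2; lia.
Qed.

Definition flip (s : bool) (z : Z) : Z := if s then (- z)%Z else z.

Lemma flip_eq0 (s : bool) (z : Z) : flip s z = 0%Z <-> z = 0%Z.
Proof. destruct s; cbn; lia. Qed.

Lemma tau_window (s : bool) (x y e : R) (z : Z * Z) :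
  let w := tau (x, y) (if s then 1 - e else e) z in
  window s e (x * IZR (flip s (fst z)) + y * IZR (flip s (snd z))
              + IZR (flip s (snd w))).
Proof.
  destruct z as [a b]; unfold tau; cbn [fst snd].
  set (v := x * IZR a + y * IZR b + _).
  destruct (Zfloor_bound v) as [h1 h2].
  destruct s; cbn [flip window]; rewrite ?opp_IZR in *; subst v; cbn in h1, h2; lra.
Qed.

Lemma srs_seq_orbit (s : bool) (x y e : R) (z : Z * Z) :
  srs_seq s x y e
    (fun n => flip s (fst (Nat.iter n (tau (x, y) (if s then 1 - e else e)) z))).
Proof. intro n; exact (tau_window s x y e (Nat.iter n _ z)). Qed.

Lemma srs_seq_determined (s : bool) (x y e : R) (u v : nat -> Z) :
  srs_seq s x y e u -> srs_seq s x y e v -> u 0%nat = v 0%nat ->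
  u 1%nat = v 1%nat -> forall n, u n = v n.
Proof.
  intros hu hv h0 h1.
  assert (h : forall n, u n = v n /\ u (S n) = v (S n)).
  { induction n as [|n [IH1 IH2]]; [now split|split; [exact IH2|]].
    specialize (hu n); specialize (hv n).
    rewrite IH1, IH2 in hu. exact (window_unique _ _ _ _ _ hu hv). }
  intro n; apply h.
Qed.

(** A half-open unit interval contains at most one integer translate of a given real, so a sequence
    obeying the window condition is the orbit of its first two terms. *)
Lemma is_eps_SRS_iff (s : bool) (x y e : R) :
  is_eps_SRS (x, y) (if s then 1 - e else e) <->
  (forall u, srs_seq s x y e u -> hits_zero u).
Proof.
  split.
  - intros h u hu.
    pose (z := (flip s (u 0%nat), flip s (u 1%nat))).
    assert (hd : forall n, u n = flip s (fst (Nat.iter n (tau (x, y) _) z)))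
      by (apply (srs_seq_determined s x y e _ _ hu (srs_seq_orbit s x y e z));
          destruct s; cbn; lia).
    destruct (h z) as [k hk]; exists k.
    assert (hk1 : snd (Nat.iter k (tau (x, y) (if s then 1 - e else e)) z) = 0%Z)
      by now rewrite hk.
    split; rewrite hd, flip_eq0; [now rewrite hk|exact hk1].
  - intros h z.
    destruct (h _ (srs_seq_orbit s x y e z)) as [k [h1 h2]]; exists k.
    rewrite flip_eq0 in h1, h2.
    exact (injective_projections _ (0, 0)%Z h1 h2).
Qed.

(** * The outer inclusion *)

(** The orbit of (a,b) never leaves [Q], yet it reaches 0. It is used by contradiction, with sets
    [Q] that omit (0,0). *)
Lemma stable_set_not_hits_zero (s : bool) (x y e : R) (Q : Z -> Z -> Prop)
    (a b : Z) :
  (forall u, srs_seq s x y e u -> hits_zero u) -> Q a b ->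
  (forall a b c, Q a b ->
     window s e (x * IZR a + y * IZR b + IZR c) -> Q b c) ->
  Q 0%Z 0%Z.
Proof.
  intros h hab hQ.
  pose (u := fun n =>
    flip s (fst (Nat.iter n (tau (x, y) (if s then 1 - e else e))
                   (flip s a, flip s b)))).
  assert (hu : srs_seq s x y e u) by apply srs_seq_orbit.
  assert (hn : forall n, Q (u n) (u (S n))).
  { induction n as [|n IH]; [|exact (hQ _ _ _ IH (hu n))].
    unfold u; cbn. replace (flip s (flip s a)) with a by (destruct s; cbn; lia).
    replace (flip s (flip s b)) with b by (destruct s; cbn; lia). exact hab. }
  destruct (h u hu) as [n [h0 h1]].
  specialize (hn n); now rewrite h0, h1 in hn.
Qed.

Definition half_range (s : bool) (e : R) : Prop :=
  if s then 0 < e <= 1/2 else 0 <= e < 1/2.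

Ltac real_le :=
  match goal with
  | |- (?a <= ?b)%Z =>
      let h := fresh in
      cut (IZR a < IZR b + 1);
      [intro h; rewrite <- plus_IZR in h; apply lt_IZR in h; lia|]
  end.

Lemma outer_x_bounds (s : bool) (x y e : R) (he : half_range s e)
    (hz : forall u, srs_seq s x y e u -> hits_zero u) :
  -1 < x /\ (if s then x <= 1 - e else x < 1 - e).
Proof.
  (* Only a state (a,0) can step to (0,0), and it does so exactly when x a lies in the window. *)
  assert (h : exists a : Z, a <> 0%Z /\ window s e (x * IZR a)).
  { apply NNPP; intro hn.
    enough (0 <> 0 \/ 0 <> 0)%Z by lia.
    apply (stable_set_not_hits_zero s x y e (fun a b => a <> 0 \/ b <> 0)%Z 1 0 hz);
      [lia|].
    intros a b c hab hw.
    destruct (Z.eq_dec b 0) as [->|hb]; [right|now left].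
    intros ->; apply hn; exists a; split; [lia|].
    now replace (x * IZR a) with (x * IZR a + y * 0 + 0) by ring. }
  destruct h as [a [ha hw]].
  assert (ha' : 1 <= IZR a \/ IZR a <= -1).
  { destruct (Z_lt_le_dec 0 a); [left|right]; apply IZR_le; lia. }
  (* A negative [a] exchanges the roles of the two window ends; e <= 1/2 keeps the upper bound on x
     valid. *)
  destruct s; cbn in hw, he |- *; split; destruct ha'; nra.
Qed.

Lemma outer_sum (s : bool) (x y e : R) (he : half_range s e)
    (hz : forall u, srs_seq s x y e u -> hits_zero u) :
  if s then - e < x + y else - e <= x + y.
Proof.
  destruct (outer_x_bounds s x y e he hz) as [hx1 hx2].
  apply NNPP; intro hn.
  destruct (classic (window s e (x + y + 1))) as [hw|hw].
  - enough (0 = 1 /\ 0 = 1)%Z by lia.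
    apply (stable_set_not_hits_zero s x y e (fun a b => a = 1 /\ b = 1)%Z 1 1 hz);
      [lia|].
    intros a b c [-> ->] hc; split; [reflexivity|].
    apply (window_unique s e (x * 1 + y * 1)); [exact hc|].
    now rewrite !Rmult_1_r.
  - assert (hxy : x + y <= - 1 - e) by (destruct s; cbn in *; lra).
    assert (he' : 0 <= e <= 1/2) by (destruct s; cbn in *; lra).
    destruct (Rle_lt_dec 0 x) as [h0|h0].
    + enough (1 <= 0 <= 0)%Z by lia.
      apply (stable_set_not_hits_zero s x y e (fun a b => 1 <= a <= b)%Z 1 1 hz);
        [lia|].
      intros a b c hab hc.
      assert (h1 : 1 <= IZR a <= IZR b) by (split; apply IZR_le; lia).
      split; [lia|real_le].
      assert (hc' : - e <= x * IZR a + y * IZR b + IZR c) by (destruct s; cbn in hc; lra).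
      nra.
    (* Here -1 < x < 0 forces y < 0 as well, so both coefficients -x and -y are positive and
       positivity alone is preserved. *)
    + enough (1 <= 0 /\ 1 <= 0)%Z by lia.
      apply (stable_set_not_hits_zero s x y e (fun a b => 1 <= a /\ 1 <= b)%Z 1 1 hz);
        [lia|].
      intros a b c hab hc.
      assert (h1 : 1 <= IZR a /\ 1 <= IZR b) by (split; apply IZR_le; lia).
      split; [lia|real_le].
      assert (hc' : - e <= x * IZR a + y * IZR b + IZR c) by (destruct s; cbn in hc; lra).
      nra.
Qed.

Lemma outer_difference (s : bool) (x y e : R) (he : half_range s e)
    (hz : forall u, srs_seq s x y e u -> hits_zero u) :
  if s then y - x <= 1 - e else y - x < 1 - e.
Proof.
  destruct (outer_x_bounds s x y e he hz) as [hx1 hx2].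
  apply NNPP; intro hn.
  (* Up to y - x = 1 the cycle 1,-1,1,... survives. Beyond it signs alternate, with nondecreasing
     absolute values when x >= 0. *)
  destruct (Rle_lt_dec (y - x) 1) as [hw|hw].
  - enough (0 = 1 /\ 0 = -1 \/ 0 = -1 /\ 0 = 1)%Z by lia.
    apply (stable_set_not_hits_zero s x y e
      (fun a b => a = 1 /\ b = -1 \/ a = -1 /\ b = 1)%Z 1 (-1) hz); [lia|].
    intros a b c hab hc.
    enough (c = a) by lia.
    apply (window_unique s e (x * IZR a + y * IZR b)); [exact hc|].
    destruct hab as [[-> ->]|[-> ->]]; destruct s; cbn in *; lra.
  - assert (he' : 0 <= e <= 1/2) by (destruct s; cbn in *; lra).
    assert (hwin : forall t, window s e t -> -1 < t < 1)
      by (intros t; destruct s; cbn in *; lra).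
    destruct (Rle_lt_dec 0 x) as [h0|h0].
    + enough (1 <= 0 <= - 0 \/ 1 <= - 0 <= 0)%Z by lia.
      apply (stable_set_not_hits_zero s x y e
        (fun a b => 1 <= a <= - b \/ 1 <= - a <= b)%Z 1 (-1) hz); [lia|].
      intros a b c hab hc; apply hwin in hc.
      destruct hab as [h|h]; [right|left]; (split; [lia|]).
      * assert (h1 : 1 <= IZR a <= - IZR b)
          by (rewrite <- opp_IZR; split; apply IZR_le; lia).
        real_le. rewrite opp_IZR. nra.
      * assert (h1 : 1 <= - IZR a <= IZR b)
          by (rewrite <- opp_IZR; split; apply IZR_le; lia).
        real_le. rewrite opp_IZR. nra.
    + enough (1 <= 0 /\ 1 <= - 0 \/ 1 <= - 0 /\ 1 <= 0)%Z by lia.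
      apply (stable_set_not_hits_zero s x y e
        (fun a b => 1 <= a /\ 1 <= - b \/ 1 <= - a /\ 1 <= b)%Z 1 (-1) hz); [lia|].
      intros a b c hab hc; apply hwin in hc.
      destruct hab as [h|h]; [right|left]; (split; [lia|]).
      * assert (h1 : 1 <= IZR a /\ 1 <= - IZR b)
          by (rewrite <- opp_IZR; split; apply IZR_le; lia).
        real_le. nra.
      * assert (h1 : 1 <= - IZR a /\ 1 <= IZR b)
          by (rewrite <- opp_IZR; split; apply IZR_le; lia).
        real_le. rewrite opp_IZR. nra.
Qed.

Lemma outer_lower (s : bool) (x y e : R) (he : half_range s e)
    (hz : forall u, srs_seq s x y e u -> hits_zero u) :
  if s then - e < x else - e <= x.
Proof.
  pose proof (outer_sum s x y e he hz) as h1; pose proof (outer_difference s x y e he hz) as h2.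
  apply NNPP; intro hn.
  enough (0 = 1 /\ 0 = 0 \/ 0 = 0 /\ 0 = 1)%Z by lia.
  apply (stable_set_not_hits_zero s x y e
    (fun a b => a = 1 /\ b = 0 \/ a = 0 /\ b = 1)%Z 1 0 hz); [lia|].
  intros a b c hab hc.
  enough (c = a) by lia.
  apply (window_unique s e (x * IZR a + y * IZR b)); [exact hc|].
  (* The bounds on x + y and y - x place both x + 1 and y in the window. *)
  destruct hab as [[-> ->]|[-> ->]]; destruct s; cbn in *; lra.
Qed.

Lemma outer_inclusion (s : bool) (x y e : R) (he : half_range s e)
    (hz : forall u, srs_seq s x y e u -> hits_zero u) :
  outer_region s x y e.
Proof.
  pose proof (outer_x_bounds s x y e he hz) as [_ h1].
  pose proof (outer_sum s x y e he hz) as h2; pose proof (outer_difference s x y e he hz) as h3.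
  pose proof (outer_lower s x y e he hz) as h4.
  destruct s; cbn; lra.
Qed.

(** * The descent of the energy *)

(** The quadratic part equals ((1+x+y)(a+b)^2 + (1+x-y)(a-b)^2)/2, which is positive definite on the
    inner region. *)
Definition energy (x y e : R) (a b : Z) : R :=
  (1 + x) * (IZR a * IZR a + IZR b * IZR b) + 2 * y * IZR a * IZR b
  - (1 - 2 * e) * (IZR a + IZR b).

(* [D] is the energy lost so far; a path is abandoned once it is positive. *)
Fixpoint escapes (s : bool) (x y e : R) (n : nat) (p q D : R) : Prop :=
  match n with
  | O => False
  | S n => (p = 0 /\ q = 0) \/
      forall g : Z, window s e (p - IZR g) ->
      let D' := D + IZR g * (2 * p - (1 + x) * IZR g - (1 - 2 * e)) in
      D' <= 0 ->
      escapes s x y e n (q - y * IZR g) (p - (1 + x) * IZR g) D'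
  end.

Lemma escapes_zero (s : bool) (x y e : R) (n : nat) (p q D : R) :
  p = 0 -> q = 0 -> escapes s x y e (S n) p q D.
Proof. now left. Qed.

Lemma escapes_step (s : bool) (x y e : R) (n : nat) (p q D : R) :
  (forall g : Z, window s e (p - IZR g) ->
     D + IZR g * (2 * p - (1 + x) * IZR g - (1 - 2 * e)) <= 0 ->
     escapes s x y e n (q - y * IZR g) (p - (1 + x) * IZR g)
       (D + IZR g * (2 * p - (1 + x) * IZR g - (1 - 2 * e)))) ->
  escapes s x y e (S n) p q D.
Proof. now right. Qed.

(** The loss is at least |g|(|g|/3 - 1), hence at least 4/3 once |g| >= 4; this is the origin of the
    bound on [D]. *)
Lemma small_jump (x e p D : R) (g : Z) :
  0 <= e -> x <= 2/3 - e -> - e <= p - IZR g <= 1 - e -> - (4/3) < D ->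
  D + IZR g * (2 * p - (1 + x) * IZR g - (1 - 2 * e)) <= 0 ->
  (-3 <= g <= 3)%Z.
Proof.
  intros he hx hp hD hd.
  set (t := p - IZR g) in *.
  replace (2 * p - (1 + x) * IZR g - (1 - 2 * e))
    with ((1 - x) * IZR g + (2 * t - (1 - 2 * e))) in hd by (unfold t; ring).
  split.
  - destruct (Z_lt_le_dec g (-3)) as [h|h]; [exfalso|exact h].
    assert (h' : IZR g <= -4) by (apply IZR_le; lia).
    nra.
  - destruct (Z_lt_le_dec 3 g) as [h|h]; [exfalso|exact h].
    assert (h' : 4 <= IZR g) by (apply IZR_le; lia).
    nra.
Qed.

(** Depth-first search over jumps: [lra] prunes branches with inconsistent window, region or energy
    constraints, and each survivor must reach 0 before the counter runs out. *)
Ltac escape :=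
  match goal with
  | |- escapes _ ?x _ ?e (S _) ?p _ ?D =>
    first
    [ apply escapes_zero; lra
    | apply escapes_step;
      let g := fresh "g" in
      let hw := fresh in let hd := fresh in
      let hg := fresh in let hg' := fresh in
      intros g hw hd; cbv beta iota delta [window] in hw;
      assert (hg : (-3 <= g <= 3)%Z) by (apply (small_jump x e p D g); lra);
      assert (hg' : (g = -3 \/ g = -2 \/ g = -1 \/ g = 0 \/
                     g = 1 \/ g = 2 \/ g = 3)%Z) by lia;
      clear hg;
      destruct hg' as [hg|[hg|[hg|[hg|[hg|[hg|hg]]]]]]; subst g;
      try (exfalso; lra); escape ]
  end.

(* Here [m = a + b] and [d = a - b].  Apart from four states next to 0, one-sided
   bounds on [p + q] and [p - q] suffice, which covers all large states at once. *)
Lemma escapes_coordinates (s : bool) (x y e p q : R) (m d k : Z) :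
  inner_region s x y e -> p + q = (1 + x + y) * IZR m ->
  p - q = (1 + x - y) * IZR d -> (m = d + 2 * k)%Z -> (m <> 0 \/ d <> 0)%Z ->
  escapes s x y e 7 p q 0.
Proof.
  intros hr hm hd hk h0.
  assert (hA : 0 <= 1 + x + y) by (destruct s; cbv [inner_region] in hr; lra).
  assert (hB : 0 <= 1 + x - y) by (destruct s; cbv [inner_region] in hr; lra).
  assert (hm_le : forall i, (i <= m)%Z -> (1 + x + y) * IZR i <= p + q)
    by (intros i hi; rewrite hm; apply Rmult_le_compat_l; [exact hA|now apply IZR_le]).
  assert (hm_ge : forall i, (m <= i)%Z -> p + q <= (1 + x + y) * IZR i)
    by (intros i hi; rewrite hm; apply Rmult_le_compat_l; [exact hA|now apply IZR_le]).
  assert (hd_le : forall i, (i <= d)%Z -> (1 + x - y) * IZR i <= p - q)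
    by (intros i hi; rewrite hd; apply Rmult_le_compat_l; [exact hB|now apply IZR_le]).
  assert (hd_ge : forall i, (d <= i)%Z -> p - q <= (1 + x - y) * IZR i)
    by (intros i hi; rewrite hd; apply Rmult_le_compat_l; [exact hB|now apply IZR_le]).
  (* [m] and [d] have equal parity and are not both 0, which limits [d] for each small [m]. *)
  assert (hcases :
    (m <= -3 \/ 4 <= m \/ m = -2 \/ m = -1 \/ m = 0 \/ m = 1 \/ m = 2 \/ m = 3)%Z)
    by lia.
  destruct hcases as [h|[h|[h|[h|[h|[h|[h|h]]]]]]];
    [ assert (h' : (0 <= d \/ d <= 0)%Z) by lia
    | assert (h' : (0 <= d \/ d <= 0)%Z) by lia
    | assert (h' : (0 <= d \/ d <= 0)%Z) by lia
    | assert (h' : (1 <= d \/ d <= -1)%Z) by lia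
    | assert (h' : (4 <= d \/ d = 2 \/ d <= -2)%Z) by lia
    | assert (h' : (3 <= d \/ d = 1 \/ d = -1 \/ d <= -3)%Z) by lia
    | assert (h' : (2 <= d \/ d = 0 \/ d <= -2)%Z) by lia
    | assert (h' : (1 <= d \/ d <= -1)%Z) by lia ];
    clear hk h0 hA hB;
    first [apply hm_le in h | apply hm_ge in h | subst m];
    repeat destruct h' as [h'|h'];
    first [apply hd_le in h' | apply hd_ge in h' | subst d];
    clear hm_le hm_ge hd_le hd_ge; try clear m hm; try clear d hd;
    destruct s; cbv [inner_region] in hr; escape.
Qed.

Lemma escapes_orbit (s : bool) (x y e : R) (u : nat -> Z) (E : R) :
  inner_region s x y e -> srs_seq s x y e u -> forall n k,
  escapes s x y e n
    ((1 + x) * IZR (u k) + y * IZR (u (S k)))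
    ((1 + x) * IZR (u (S k)) + y * IZR (u k))
    (E - energy x y e (u k) (u (S k))) ->
  hits_zero u \/ exists m, energy x y e (u m) (u (S m)) < E.
Proof.
  intros hr hu n; induction n as [|n IH]; intros k h; [contradiction|].
  destruct h as [[hp hq]|h].
  - left; exists k.
    assert (hA : 0 < 1 + x + y) by (destruct s; cbv [inner_region] in hr; lra).
    assert (hB : 0 < 1 + x - y) by (destruct s; cbv [inner_region] in hr; lra).
    (* p + q and p - q are a + b and a - b times the positive factors 1+x+y and 1+x-y. *)
    assert (hs : IZR (u k) + IZR (u (S k)) = 0) by nra.
    assert (hd : IZR (u k) - IZR (u (S k)) = 0) by nra.
    split; apply eq_IZR; lra.
  - specialize (h (u k - u (S (S k)))%Z).
    rewrite minus_IZR in h.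
    set (a := IZR (u k)) in *; set (b := IZR (u (S k))) in *.
    set (c := IZR (u (S (S k)))) in *.
    match type of h with
    | _ -> let D' := ?D in _ =>
      replace D with (E - energy x y e (u (S k)) (u (S (S k)))) in h
        by (unfold energy; fold a b c; ring)
    end.
    destruct (Rle_lt_dec E (energy x y e (u (S k)) (u (S (S k))))) as [hE|hE];
      [|right; now exists (S k)].
    apply (IH (S k)).
    fold b c.
    replace ((1 + x) * b + y * c) with ((1 + x) * b + y * a - y * (a - c)) by ring.
    replace ((1 + x) * c + y * b)
      with ((1 + x) * a + y * b - (1 + x) * (a - c)) by ring.
    apply h; [|lra].
    replace ((1 + x) * a + y * b - (a - c)) with (x * a + y * b + c) by ring.
    exact (hu k).
Qed.

Lemma energy_descent (s : bool) (x y e : R) (u : nat -> Z) :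
  inner_region s x y e -> srs_seq s x y e u -> ~ hits_zero u ->
  forall n, exists m,
    energy x y e (u m) (u (S m)) < energy x y e (u n) (u (S n)).
Proof.
  intros hr hu hz n.
  destruct (escapes_orbit s x y e u (energy x y e (u n) (u (S n))) hr hu 7 n)
    as [h|h]; [|contradiction|exact h].
  rewrite Rminus_diag.
  apply (escapes_coordinates s x y e _ _
    (u n + u (S n)) (u n - u (S n)) (u (S n)) hr).
  - rewrite plus_IZR; ring.
  - rewrite minus_IZR; ring.
  - lia.
  - destruct (Z.eq_dec (u n) 0) as [h1|h1]; [|lia].
    destruct (Z.eq_dec (u (S n)) 0) as [h2|h2]; [|lia].
    exfalso; apply hz; now exists n.
Qed.

(** * Finite sublevel sets and termination *)

Lemma energy_sublevel_bounded (s : bool) (x y e E : R) :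
  inner_region s x y e -> exists N : Z, forall a b,
  energy x y e a b <= E -> (- N <= a <= N /\ - N <= b <= N)%Z.
Proof.
  intro hr.
  (* The least eigenvalue of the quadratic part. *)
  set (m := Rmin (1 + x + y) (1 + x - y)).
  assert (hm : 0 < m) by (apply Rmin_glb_lt; destruct s; cbv [inner_region] in hr; lra).
  assert (hm1 : m <= 1 + x + y) by apply Rmin_l.
  assert (hm2 : m <= 1 + x - y) by apply Rmin_r.
  assert (he : 0 <= 1 - 2 * e <= 1) by (destruct s; cbv [inner_region] in hr; lra).
  assert (habs : forall t : R, (1 - 2 * e) * t <= Rabs t).
  { intro t; pose proof (Rle_abs t) as h1; pose proof (Rabs_pos t) as h2.
    clear - he h1 h2; nra. }
  assert (hbound : forall a b : R,
    m * (a * a + b * b) - Rabs a - Rabs b <=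
    (1 + x) * (a * a + b * b) + 2 * y * a * b - (1 - 2 * e) * (a + b)).
  { intros a b.
    pose proof (Rmult_le_compat_r _ _ _ (Rle_0_sqr (a + b)) hm1).
    pose proof (Rmult_le_compat_r _ _ _ (Rle_0_sqr (a - b)) hm2).
    unfold Rsqr in *.
    pose proof (habs a); pose proof (habs b).
    lra. }
  assert (hi : 0 < / m) by now apply Rinv_0_lt_compat.
  assert (hmi : m * / m = 1) by (apply Rinv_r; lra).
  assert (hsqr : forall t : R, t * t = Rabs t * Rabs t) by exact Rsqr_abs.
  (* Beyond [K] one coordinate contributes more than E + 1/m, while the other contributes at least
     -1/m. *)
  set (K := 3 * / m + Rabs E).
  assert (hquad : forall t : R, - / m <= m * (t * t) - Rabs t).
  { intro t; rewrite hsqr; set (v := Rabs t).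
    assert (hv : 0 <= Rsqr (m * v - 1/2) * / m)
      by (apply Rmult_le_pos; [apply Rle_0_sqr|lra]).
    replace (Rsqr (m * v - 1/2) * / m) with (m * (v * v) - v + 1/4 * / m) in hv
      by (unfold Rsqr; field; lra).
    lra. }
  assert (hlarge : forall t : R, K < Rabs t -> E + / m < m * (t * t) - Rabs t).
  { intros t hK; rewrite hsqr; set (v := Rabs t) in *.
    pose proof (Rle_abs E) as hE; pose proof (Rabs_pos E) as hE0.
    unfold K in hK.
    assert (hmv : 2 <= m * v) by (clear - hm hi hmi hK hE0; nra).
    clear - hmv hK hE hE0 hi; nra. }
  destruct (archimed K) as [hup _].
  exists (up K); intros a b hE.
  unfold energy in hE.
  specialize (hbound (IZR a) (IZR b)).
  assert (hab : Rabs (IZR a) <= K /\ Rabs (IZR b) <= K).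
  { pose proof (hquad (IZR a)); pose proof (hquad (IZR b)).
    split; apply Rnot_lt_le; intro hl; apply hlarge in hl; lra. }
  destruct hab as [ha hb].
  apply (fun h => Rabs_def2 _ _ (Rle_lt_trans _ _ _ h hup)) in ha, hb.
  repeat split; apply le_IZR; rewrite ?opp_IZR; lra.
Qed.

Lemma exists_list_min {A : Type} (f : A -> R) (Q : A -> Prop) (l : list A) :
  (exists z, List.In z l /\ Q z) ->
  exists z, Q z /\ forall w, List.In w l -> Q w -> f z <= f w.
Proof.
  induction l as [|a l IH]; intros [z [hz hQ]]; [contradiction|].
  destruct (classic (exists z, List.In z l /\ Q z)) as [h|h].
  - destruct (IH h) as [m [hm hmin]].
    destruct (classic (Q a /\ f a < f m)) as [[ha hlt]|hn].
    + exists a; split; [exact ha|]. intros w [->|hw] hQw; [lra|].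
      specialize (hmin w hw hQw); lra.
    + exists m; split; [exact hm|]. intros w [->|hw] hQw; [|now apply hmin].
      apply Rnot_lt_le; intro; apply hn; now split.
  - destruct hz as [->|hz]; [|exfalso; apply h; now exists z].
    exists z; split; [exact hQ|].
    intros w [->|hw] hQw; [lra|]. exfalso; apply h; now exists w.
Qed.

Definition Zrange (N : Z) : list Z :=
  map (fun n => (Z.of_nat n - N)%Z) (seq 0 (Z.to_nat (2 * N + 1))).

Lemma in_Zrange (N a : Z) : (- N <= a <= N)%Z -> List.In a (Zrange N).
Proof.
  intro h; apply in_map_iff; exists (Z.to_nat (a + N)); split; [lia|].
  apply in_seq; lia.
Qed.

Lemma inner_inclusion (s : bool) (x y e : R) (u : nat -> Z) :
  inner_region s x y e -> srs_seq s x y e u -> hits_zero u.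
Proof.
  intros hr hu; apply NNPP; intro hz.
  pose proof (energy_descent s x y e u hr hu hz) as hdesc.
  set (f := fun z : Z * Z => energy x y e (fst z) (snd z)).
  destruct (energy_sublevel_bounded s x y e (f (u 0%nat, u 1%nat)) hr) as [N hN].
  set (l := list_prod (Zrange N) (Zrange N)).
  assert (hl : forall z, f z <= f (u 0%nat, u 1%nat) -> List.In z l).
  { intros [a b] h; apply hN in h; apply in_prod; apply in_Zrange; apply h. }
  (* A visited state of least energy exists because [l] contains every state with energy at most the
     initial one; descent from it is the contradiction. *)
  destruct (exists_list_min f (fun z => exists n, z = (u n, u (S n))) l)
    as [z [[n ->] hmin]].
  { exists (u 0%nat, u 1%nat); split; [apply hl, Rle_refl|now exists 0%nat]. }
  assert (h0 : f (u n, u (S n)) <= f (u 0%nat, u 1%nat)).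
  { apply hmin; [apply hl, Rle_refl|now exists 0%nat]. }
  destruct (hdesc n) as [m hm].
  assert (h1 : f (u n, u (S n)) <= f (u m, u (S m))).
  { apply hmin; [apply hl; unfold f in *; cbn in *; lra|now exists m]. }
  unfold f in h1; cbn in h1; lra.
Qed.

Theorem theorem3p1 (eps : R) (heps : 0 <= eps < 1) :
  Included (R * R) (Bset eps) (D0_2 eps) /\
  Included (R * R) (D0_2 eps) (Dset eps).
Proof.
  split; intros [x y] h; unfold In, D0_2 in *.
  - destruct h as [h|h].
    + apply (is_eps_SRS_iff false x y eps); intros u hu.
      apply (inner_inclusion false x y eps u); [cbv [inner_region]; lra|exact hu].
    + replace eps with (1 - (1 - eps)) by ring.
      apply (is_eps_SRS_iff true x y (1 - eps)); intros u hu.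
      apply (inner_inclusion true x y (1 - eps) u); [cbv [inner_region]; lra|exact hu].
  - destruct (Rlt_le_dec eps (1/2)) as [h2|h2]; [left|right].
    + assert (ho := outer_inclusion false x y eps (conj (proj1 heps) h2)
                      (proj1 (is_eps_SRS_iff false x y eps) h)).
      cbn in ho; lra.
    + replace eps with (1 - (1 - eps)) in h by ring.
      assert (he : half_range true (1 - eps)) by (cbn; lra).
      assert (ho := outer_inclusion true x y (1 - eps) he
                      (proj1 (is_eps_SRS_iff true x y (1 - eps)) h)).
      cbn in ho; lra.
Qed.
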